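(* Let $A$ be a finite totally ordered alphabet, let $M=\{n_{1},\dots,n_{t}\}$ be a finite multiset of necklaces with $n_{i}=n(u_{i})$ for primitive words $u_{i}$, and let $n=|n_{1}|+\cdots+|n_{t}|$. Let $w=BW(M)\in A^{n}$ and let $S(M)$ be the subsemigroup of $POI_{n}$ generated by the mappings $\pi_{a}$ $(a\in A)$ of the standard permutation $\pi=\pi(w)$. Then $S(M)$ is isomorphic to a subdirect product of the syntactic semigroups $S_{u_{1}},\dots,S_{u_{t}}$.
   Context: Words are compared lexicographically. A word is primitive if it is not a proper power of another word; a necklace is the set of conjugates ($xy\sim yx$) of a primitive word, and its length is the length of its words. $[n]=\{0<1<\cdots<n-1\}$; $POI_{n}$ is the semigroup of all one-to-one, order-preserving partial maps on $[n]$ under composition (maps composed left to right). Burrows–Wheeler map: given a multiset $M$ of necklaces, let $l$ be the lcm of their lengths; form the list of all words $v^{l/|v|}$ where $v$ ranges over the words of each necklace of $M$ (with multiplicity), sorted lexicographically; this is an $n\times l$ table $T(M)$ and $BW(M)$ is its last column read top to bottom. Standard permutation of $w\in A^{n}$: let $f(w)$ be the letters of $w$ rearranged in nondecreasing order; for each letter $a$, $\pi_{a}$ is the unique order-preserving injective partial map on $[n]$ whose domain is the set of positions of $a$ in $f(w)$ and whose range is the set of positions of $a$ in $w$ (positions indexed from $0$; $\pi_a$ is empty if $a$ does not occur in $w$); $\pi(w)=\bigcup_{a}\pi_{a}$. For primitive $u$, $\langle u\rangle=\{u^{m}:m\ge1\}$, $\rho_{u}$ is the syntactic congruence of $\langle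 u\rangle$ on $A^{+}$ ($x\rho_{u}y$ iff for all $p,q\in A^{*}$: $pxq\in\langle u\rangle\Leftrightarrow pyq\in\langle u\rangle$), and $S_{u}=A^{+}/\rho_{u}$. A subdirect product of semigroups $S_{1},\dots,S_{t}$ is a subsemigroup of $S_{1}\times\cdots\times S_{t}$ whose projection onto each factor is surjective. *)

(* Defs.v *)
From HB Require Import structures.
From mathcomp Require Import all_boot all_order.
From Stdlib Require Import ClassicalEpsilon.

Set Implicit Arguments.
Unset Strict Implicit.
Unset Printing Implicit Defensive.

Section Defs.
Variables (d : Order.disp_t) (A : finOrderType d).

Fixpoint lex_le (x y : seq A) : bool :=
  match x, y with
  | [::], _ => true
  | _ :: _, [::] => false
  | a :: x', b :: y' => (a < b)%O || ((a == b) && lex_le x' y')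
  end.

Definition wpow (v : seq A) (k : nat) : seq A := flatten (nseq k v).

Definition primitive (u : seq A) : Prop :=
  u != [::] /\ forall (v : seq A) (k : nat), u = wpow v k -> k = 1.

Definition necklace (u : seq A) : seq (seq A) :=
  undup [seq rot i u | i <- iota 0 (size u)].

(* The multiset M = {n(u) | u <- us} (with multiplicity). *)
Definition bw_lcm (us : seq (seq A)) : nat := foldr lcmn 1 [seq size u | u <- us].

Definition bw_rows (us : seq (seq A)) : seq (seq A) :=
  flatten [seq [seq wpow v (bw_lcm us %/ size v) | v <- necklace u] | u <- us].

Definition bw_table (us : seq (seq A)) : seq (seq A) := sort lex_le (bw_rows us).

Definition BW (us : seq (seq A)) : seq A :=
  flatten [seq take 1 (rev r) | r <- bw_table us].

Definition positions (s : seq A) (a : A) : seq nat :=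
  [seq p.1 | p <- zip (iota 0 (size s)) s & p.2 == a].

Definition pmap (n : nat) := {ffun 'I_n -> option 'I_n}.

Definition pcomp (n : nat) (f g : pmap n) : pmap n :=
  [ffun x => obind (fun y => g y) (f x)].

(* pi_a for the standard permutation of w: the unique order-preserving
   injective partial map sending the k-th position of a in f(w) = sort w
   to the k-th position of a in w. *)
Definition std_perm_map (w : seq A) (a : A) : pmap (size w) :=
  [ffun i : 'I_(size w) =>
     let pf := positions (sort <=%O w) a in
     let k := index (val i) pf in
     if k < size pf then insub (nth 0 (positions w a) k) else None].

Inductive generated (n : nat) (X : pmap n -> Prop) : pmap n -> Prop :=
  | gen_base f : X f -> generated X f
  | gen_comp f g : generated X f -> generated X g -> generated X (pcomp f g).

End Defs.

(* A set with a binary operation (all instances below are semigroups). *)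
Record magma := Magma { mcarrier :> Type; mop : mcarrier -> mcarrier -> mcarrier }.

Section Semigroups.
Variables (d : Order.disp_t) (A : finOrderType d).

Definition SM_carrier (us : seq (seq A)) :=
  {f : pmap (size (BW us)) | generated (fun g => exists a : A, g = std_perm_map (BW us) a) f}.

Definition SM_op (us : seq (seq A)) (x y : SM_carrier us) : SM_carrier us :=
  exist _ (pcomp (proj1_sig x) (proj1_sig y)) (gen_comp (proj2_sig x) (proj2_sig y)).

Definition SM (us : seq (seq A)) : magma := @Magma (SM_carrier us) (@SM_op us).

Definition in_pow (u z : seq A) : Prop := exists m, 0 < m /\ z = wpow u m.

Definition rho (u x y : seq A) : Prop :=
  forall p q : seq A, in_pow u (p ++ x ++ q) <-> in_pow u (p ++ y ++ q).

Definition rho_class (u x : seq A) : seq A -> Prop := fun y => y != [::] /\ rho u x y.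

Definition Su_carrier (u : seq A) :=
  {C : seq A -> Prop | exists x, x != [::] /\ C = rho_class u x}.

Definition Su_rep (u : seq A) (C : Su_carrier u) : seq A :=
  proj1_sig (constructive_indefinite_description _ (proj2_sig C)).

Lemma Su_rep_spec (u : seq A) (C : Su_carrier u) :
  Su_rep C != [::] /\ proj1_sig C = rho_class u (Su_rep C).
Proof. exact: (proj2_sig (constructive_indefinite_description _ (proj2_sig C))). Qed.

Lemma cat_nonnil (x y : seq A) : x != [::] -> x ++ y != [::].
Proof. by case: x. Qed.

Definition Su_op (u : seq A) (C D : Su_carrier u) : Su_carrier u :=
  exist _ (rho_class u (Su_rep C ++ Su_rep D))
    (ex_intro _ (Su_rep C ++ Su_rep D)
       (conj (cat_nonnil (Su_rep D) (proj1 (Su_rep_spec C))) erefl)).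

Definition Su (u : seq A) : magma := @Magma (Su_carrier u) (@Su_op u).

End Semigroups.

Definition prod_op (t : nat) (S : 'I_t -> magma) (p q : forall i, S i) : forall i, S i :=
  fun i => mop (p i) (q i).

Definition is_subdirect (t : nat) (S : 'I_t -> magma) (P : (forall i, S i) -> Prop) : Prop :=
  (forall p q, P p -> P q -> P (prod_op p q)) /\
  (forall (i : 'I_t) (s : S i), exists p, P p /\ p i = s).

Definition iso_to_subdirect (M : magma) (t : nat) (S : 'I_t -> magma) : Prop :=
  exists P : (forall i, S i) -> Prop, is_subdirect P /\
  exists f : M -> forall i, S i,
    (forall x y : M, f (mop x y) = prod_op (f x) (f y)) /\ injective f /\
    (forall p, P p <-> exists x, f x = p).

(* Main.v *)
(** Reading a word letter by letter along a circular word, rotating it at each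
    step, makes the conjugates of a primitive word [u] the states of the minimal
    automaton of [<u>]: words are [rho_u]-equivalent iff they act in the same
    way on these conjugates.  On the other side, write [T] for the sorted
    Burrows-Wheeler table.  Since rotation preserves the multiset of rows, and
    is order-preserving on the rows starting with [a], [pi_a] sends the [k]-th
    copy of a row [r] starting with [a] to the [k]-th copy of the rotated row.
    Hence the composite of the [pi_a] along [x] is determined by the action of
    [x] on the rows, i.e. on the conjugates of all the [u_i], so two words give
    the same element of [S(M)] iff they are [rho_{u_i}]-equivalent for all [i]. *)

Require Import Defs.
From HB Require Import structures.
From mathcomp Require Import all_boot all_order.
From Stdlib Require Import ClassicalEpsilon FunctionalExtensionality.
From Stdlib Require Import PropExtensionality ProofIrrelevance.
Import Defs. (* the names pmap and pcomp are shadowed by MathComp's *)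

Set Implicit Arguments.
Unset Strict Implicit.
Unset Printing Implicit Defensive.

(** * Counting occurrences in prefixes of a list *)

Section SeqFacts.
Variable T : eqType.
Implicit Types (s : seq T) (P : pred T).

Lemma exists_count_take x0 P s k : k < count P s ->
  exists2 i, i < size s & P (nth x0 s i) /\ count P (take i s) = k.
Proof.
elim: s k => [|y s IHs] k //=; case: (boolP (P y)) => Py; rewrite ?add0n.
  case: k => [|k]; first by exists 0.
  by rewrite ltnS => /IHs [i lti [Pi <-]]; exists i.+1; rewrite //= Py.
by move/IHs=> [i lti [Pi <-]]; exists i.+1; rewrite //= (negPf Py).
Qed.

Lemma count_take_lt x0 P s i : i < size s -> P (nth x0 s i) ->
  forall j, i < j -> count P (take i s) < count P (take j s).
Proof.
move=> lti Pi j ltij.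
have -> : take i s = take i (take j s) by rewrite take_takel // ltnW.
rewrite -{2}(cat_take_drop i (take j s)) count_cat -[X in X < _]addn0 ltn_add2l.
have ltij' : i < size (take j s) by rewrite size_take; case: ifP.
by rewrite (drop_nth x0) //= nth_take // Pi.
Qed.

(* The number of earlier copies of the [i]-th item: it separates equal rows. *)
Definition rank x0 s i := count_mem (nth x0 s i) (take i s).

Lemma rank_inj x0 s i j : i < size s -> j < size s ->
  nth x0 s i = nth x0 s j -> rank x0 s i = rank x0 s j -> i = j.
Proof.
rewrite /rank => lti ltj eqn eqr.
have lt k l : k < size s -> nth x0 s k = nth x0 s l -> k < l ->
    count_mem (nth x0 s k) (take k s) < count_mem (nth x0 s l) (take l s).
  by move=> ltk ekl; rewrite -ekl; apply: (@count_take_lt x0); rewrite //= eqxx.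
case: (ltngtP i j) => // [/(lt _ _ lti eqn)|/(lt _ _ ltj (esym eqn))];
  by rewrite eqr ltnn.
Qed.

Lemma rank_lt_count x0 s i : i < size s -> rank x0 s i < count_mem (nth x0 s i) s.
Proof.
move=> lti; rewrite -{3}(take_size s).
by apply: (@count_take_lt x0); rewrite //= eqxx.
Qed.

(** Items from position [i] on are above the [i]-th one, and earlier ones are strictly smaller or
    copies of it. The count thus splits into an order part and a rank, which can be compared
    separately. *)
Lemma count_take_sorted (le : rel T) x0 P s i :
    transitive le -> reflexive le -> antisymmetric le ->
    sorted le s -> i < size s -> P (nth x0 s i) ->
  count P (take i s)
  = count (fun r => P r && ~~ le (nth x0 s i) r) s + rank x0 s i.
Proof.
move=> le_tr le_refl le_anti s_sorted lti Pi; set r0 := nth x0 s i in Pi *.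
rewrite /rank -/r0 -[in X in X + _](cat_take_drop i s) count_cat.
have -> : count (fun r => P r && ~~ le r0 r) (drop i s) = 0.
  apply/eqP; rewrite eqn0Ngt -has_count; apply/hasPn => r.
  case/(nthP x0) => j; rewrite size_drop nth_drop => ltj <-.
  rewrite negb_and negbK (sorted_leq_nth le_tr le_refl x0 s_sorted) ?orbT //.
    by rewrite inE -ltn_subRL.
  exact: leq_addr.
rewrite addn0 -count_predUI [X in _ = _ + X](_ : _ = 0) ?addn0.
  apply: eq_in_count => r /(nthP x0) [j]; rewrite size_take_min leq_min => /andP[ltji ltj].
  rewrite nth_take // => <- /=; case: eqP => [->|neq]; first by rewrite orbT.
  rewrite orbF; case: (boolP (le _ _)) => [le1|]; last by rewrite andbT.
  case: neq; apply: le_anti; rewrite le1 andbT.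
  by apply: (sorted_leq_nth le_tr le_refl x0 s_sorted) => //; exact: ltnW.
apply/eqP; rewrite eqn0Ngt -has_count; apply/hasPn => r _ /=.
by apply/negP => /andP[/andP[_ /negP nle] /eqP er]; case: nle; rewrite er.
Qed.

End SeqFacts.

Section Words.
Variables (d : Order.disp_t) (A : finOrderType d).
Implicit Types (u v x y z r s : seq A) (a b : A).

(** * The lexicographic order *)

Lemma lex_le_refl : reflexive (@lex_le d A).
Proof. by elim=> //= a x ->; rewrite eqxx orbT. Qed.

Lemma lex_le_trans : transitive (@lex_le d A).
Proof.
move=> y x z; elim: x y z => [|a x IHx] [|b y] [|c z] //=.
case/orP=> [ab|/andP[/eqP-> xy]] /orP[bc|/andP[/eqP<- yz]].
- by rewrite (Order.POrderTheory.lt_trans ab bc).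
- by rewrite ab.
- by rewrite bc.
by rewrite eqxx (IHx _ _ xy yz) orbT.
Qed.

Lemma lex_le_anti : antisymmetric (@lex_le d A).
Proof.
elim=> [|a x IHx] [|b y] //= /andP[/orP[ab|/andP[/eqP-> xy]]].
  case/orP=> [ba|/andP[/eqP ba _]]; last by rewrite ba Order.POrderTheory.ltxx in ab.
  by have := Order.POrderTheory.lt_trans ab ba; rewrite Order.POrderTheory.ltxx.
by rewrite Order.POrderTheory.ltxx eqxx /= => yx; rewrite (IHx y) // xy yx.
Qed.

Lemma lex_le_total : total (@lex_le d A).
Proof.
elim=> [|a x IHx] [|b y] //=.
by case: (Order.TotalTheory.ltgtP a b) => //= _; exact: IHx.
Qed.

(** With equal lengths, the appended letter is compared only after a tie. This makes rotation
    monotone on rows sharing their first letter. *)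
Lemma lex_le_rcons x y a : size x = size y ->
  lex_le (rcons x a) (rcons y a) = lex_le x y.
Proof.
elim: x y => [|b x IHx] [|c y] //=; first by rewrite eqxx orbT.
by case=> /IHx ->.
Qed.

(** * Powers of words and commutation *)

Lemma wpowS v k : wpow v k.+1 = v ++ wpow v k. Proof. by []. Qed.

Lemma wpowD v k l : wpow v (k + l) = wpow v k ++ wpow v l.
Proof. by elim: k => // k IHk; rewrite addSn !wpowS IHk catA. Qed.

Lemma size_wpow v k : size (wpow v k) = k * size v.
Proof. by elim: k => // k IHk; rewrite wpowS size_cat IHk mulSn. Qed.

Lemma wpow_inj v v' k : 0 < k -> size v = size v' -> wpow v k = wpow v' k -> v = v'.
Proof.
case: k => // k _ sz; rewrite !wpowS => /eqP; rewrite eqseq_cat //.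
by case/andP=> /eqP.
Qed.

Lemma wpow_rot1 v k : rot 1 (wpow v k) = wpow (rot 1 v) k.
Proof.
case: v => [|b v]; first by elim: k.
rewrite rot1_cons; case: k => // k.
rewrite wpowS cat_cons rot1_cons wpowS cat_rcons rcons_cat; congr (_ ++ _).
by elim: k => // k IHk; rewrite wpowS wpowS cat_rcons -IHk -rcons_cat.
Qed.

(** Euclid's algorithm on the lengths: the shorter word is a prefix of the longer one, and stripping
    it leaves a commuting pair. *)
Lemma commuting_powers x y : x ++ y = y ++ x ->
  exists v k l, x = wpow v k /\ y = wpow v l.
Proof.
have [m] := ubnP (size x + size y); elim: m x y => // m IHm x y.
wlog lexy : x y / size x <= size y => [hw|] lem e.
  case/orP: (leq_total (size x) (size y)) => sxy; first exact: hw.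
  by have [|v [k [l [-> ->]]]] := hw y x sxy _ (esym e);
    [rewrite addnC | exists v, l, k].
have [x0|x0] := eqVneq x [::].
  by exists y, 0, 1; rewrite x0 /wpow /= cats0.
have ey : y = x ++ drop (size x) y.
  rewrite -{1}(cat_take_drop (size x) y); congr (_ ++ _).
  by have := congr1 (take (size x)) e; rewrite take_size_cat // takel_cat.
move: (drop _ _) ey => y' ey; subst y.
have e' : x ++ y' = y' ++ x.
  by apply/eqP; move/eqP: e; rewrite -catA eqseq_cat // eqxx.
have [|v [k [l [ex ey']]]] := IHm _ _ _ e'.
  move: lem; rewrite size_cat ltnS; apply: leq_trans.
  by rewrite -[X in X < _]add0n ltn_add2r lt0n size_eq0.
by exists v, k, (k + l); rewrite wpowD -ex -ey'.
Qed.

(** The exponents over a common root [v] add up to 1 by primitivity, so one of them is 0. *)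
Lemma primitive_commute x y : primitive (x ++ y) -> x ++ y = y ++ x ->
  x = [::] \/ y = [::].
Proof.
move=> [_ prim] /commuting_powers [v [k [l [ex ey]]]].
have := prim v (k + l); rewrite wpowD -ex -ey => /(_ erefl).
by case: k ex => [|[|k]] -> //; [left | case: l ey => // ->; right].
Qed.

(** * Reading words along circular words *)

Definition step r a : option (seq A) :=
  if r is b :: r' then (if b == a then Some (rcons r' b) else None) else None.

(* [run x r] reads [x] along the circular word [r]: it is [Some] of the rotation
   of [r] by [size x] letters if [x] is a prefix of [rrr...], [None] otherwise. *)
Fixpoint run x r : option (seq A) :=
  if x is a :: x' then obind (run x') (step r a) else Some r.

Lemma run_cat x y r : run (x ++ y) r = obind (run y) (run x r).
Proof. by elim: x r => //= a x IHx r; case: (step r a) => /=. Qed.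

Lemma run_self x y : run x (x ++ y) = Some (y ++ x).
Proof.
elim: x y => [|a x IHx] y /=; first by rewrite cats0.
by rewrite eqxx /= rcons_cat IHx cat_rcons.
Qed.

Lemma step_rot1 r a s : step r a = Some s -> s = rot 1 r.
Proof. by case: r => //= b r; case: eqP => // _ [<-]; rewrite rot1_cons. Qed.

Lemma run_rot x r s : run x r = Some s -> s = iter (size x) (rot 1) r.
Proof.
elim: x r => [|a x IHx] r /=; first by case.
by case e: (step r a) => [r'|] //= /IHx ->; rewrite (step_rot1 e) -iterSr.
Qed.

(** Both words are recovered by undoing [size x] rotations, so each word acts as a partial
    injection. *)
Lemma run_inj x r r' s : run x r = Some s -> run x r' = Some s -> r = r'.
Proof.
move=> /run_rot -> /run_rot; elim: (size x) => //= m IHm /rot_inj; exact: IHm.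
Qed.

Lemma size_run x r s : run x r = Some s -> size s = size r.
Proof. by move/run_rot->; elim: (size x) => //= m; rewrite size_rot. Qed.

Lemma run_prefix x r s : size x <= size r -> run x r = Some s -> x = take (size x) r.
Proof.
(* Letters already read move to the end, so the induction reads along [r ++ t] with a growing tail
   [t], initially empty. *)
rewrite -{2}(cats0 r); elim: x r [::] s => [|a x IHx] [|b r] t s //=.
rewrite ltnS => sz; case: eqP => // -> /=; rewrite rcons_cat.
by move/(IHx _ _ _ sz) => <-.
Qed.

(** Going round a nonempty [v] or round a positive power of it spells the same infinite word. Rows
    of the table can thus stand for conjugates. *)
Lemma run_wpow x v k : 0 < k -> run x (wpow v k) = omap (fun s => wpow s k) (run x v).
Proof.
move=> k0; elim: x v => //= a x IHx [|b v] /=.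
  by rewrite (_ : wpow [::] k = [::]) //; elim: (k).
have := wpow_rot1 (b :: v) k; case: k k0 IHx => // k _ IHx.
rewrite rot1_cons wpowS cat_cons rot1_cons /= => ->.
by case: eqP => //= _; rewrite IHx.
Qed.

(** For the converse, full turns around [u] are peeled off by induction on [size z]; primitivity
    forbids being back at [u] before a full turn. *)
Lemma in_powP u z : primitive u -> z != [::] -> in_pow u z <-> run z u = Some u.
Proof.
move=> prim_u z0; split=> [[m [_ ->]]|].
  elim: m => // m IHm; rewrite wpowS run_cat.
  by have := run_self u [::]; rewrite cats0 => ->.
have [m] := ubnP (size z); elim: m z z0 => // m IHm z z0; rewrite ltnS => szm ru.
have [ltzu|leuz] := ltnP (size z) (size u).
  have ez := run_prefix (ltnW ltzu) ru.
  have eu : u = z ++ drop (size z) u by rewrite {1}ez cat_take_drop.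
  (* After reading [z] the circular word is [y ++ z]; being back at [u] makes [z] and [y]
     commute. *)
  move: (drop _ _) eu => y eu; move: ru; rewrite {1}eu run_self => -[eyz].
  have [||zn|yn] := @primitive_commute z y.
  - by rewrite -eu.
  - by rewrite -eu eyz.
  - by rewrite zn in z0.
  - by move: ltzu; rewrite eu yn cats0 ltnn.
(* The first [size u] letters of [z] can be read along [u], so they spell [u]. *)
have ez : z = u ++ drop (size u) z.
  rewrite -{1}(cat_take_drop (size u) z); congr (_ ++ _).
  move: ru; rewrite -{1}(cat_take_drop (size u) z) run_cat.
  case e: (run _ u) => [s|] // _.
  have := run_prefix _ e; rewrite size_takel // => -> //.
  by rewrite take_size.
move: (drop _ _) ez => z' ez; subst z.
have [z'0|z'0] := eqVneq z' [::].
  by exists 1; rewrite z'0.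
have su : 0 < size u by case: prim_u => u0 _; rewrite lt0n size_eq0.
have [||k [k0 ->]] := IHm z' z'0.
- by apply: leq_trans szm; rewrite size_cat -[X in X < _]add0n ltn_add2r.
- by move: ru; rewrite run_cat; have := run_self u [::]; rewrite cats0 => ->.
by exists k.+1.
Qed.

(** * Conjugates of a word and the syntactic congruence *)

Lemma necklaceP u v : reflect (exists2 j, j < size u & v = rot j u) (v \in necklace u).
Proof.
rewrite mem_undup; apply: (iffP mapP) => [] [j].
  by rewrite mem_iota add0n => ltj ->; exists j.
by move=> ltj ->; exists j; rewrite ?mem_iota.
Qed.

Lemma size_necklace u v : v \in necklace u -> size v = size u.
Proof. by case/necklaceP=> j _ ->; rewrite size_rot. Qed.

Lemma necklace_rot1 u v : v \in necklace u -> rot 1 v \in necklace u.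
Proof.
case/necklaceP=> j ltj ->; apply/necklaceP; rewrite -rotS //.
case: (ltngtP j.+1 (size u)) => [lt|gt|eq]; first by exists j.+1.
  by rewrite ltnNge ltj in gt.
by exists 0; [exact: leq_ltn_trans ltj | rewrite eq rot_size rot0].
Qed.

Lemma run_necklace u v x s : v \in necklace u -> run x v = Some s -> s \in necklace u.
Proof. by move=> vu /run_rot ->; elim: (size x) => //= m /necklace_rot1. Qed.

Lemma perm_necklace_rot1 u : perm_eq (map (rot 1) (necklace u)) (necklace u).
Proof.
have us : uniq (map (rot 1) (necklace u)).
  by rewrite map_inj_uniq ?undup_uniq //; exact: rot_inj.
apply: uniq_perm; rewrite ?undup_uniq //.
have sub : {subset map (rot 1) (necklace u) <= necklace u}.
  by move=> _ /mapP[v vu ->]; exact: necklace_rot1.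
by have [] := uniq_min_size us sub; rewrite ?size_map.
Qed.

(* The conjugates of a primitive word are the states of the minimal automaton
   of its powers, with [run] as transition function. *)
Lemma rho_run u x y : primitive u -> x != [::] -> y != [::] ->
  rho u x y <-> {in necklace u, run x =1 run y}.
Proof.
move=> prim_u x0 y0.
have ctx0 p q t : t != [::] -> p ++ t ++ q != [::] by case: p => //; case: t.
have [u_nil _] := prim_u; have su : 0 < size u by rewrite lt0n size_eq0.
have uu : u \in necklace u by apply/necklaceP; exists 0; rewrite ?rot0.
split=> [rxy v vu|rxy p q]; last first.
  rewrite !in_powP ?ctx0 // !run_cat.
  case e: (run p u) => [v|] //=; rewrite !run_cat rxy //; exact: run_necklace e.
have transfer x' y' s : x' != [::] -> y' != [::] -> rho u x' y' ->
    run x' v = Some s -> run y' v = Some s.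
  move=> x'0 y'0 rho' e'.
  have /necklaceP[j _ ev] := vu.
  have /necklaceP[l _ es] := run_necklace vu e'.
  (* The context [take j u], [drop l u] leads from [u] to [v] and from [s] back to [u]. Hence [y']
     read from [v] reaches a word that [drop l u] also sends to [u]; by [run_inj] it is [s]. *)
  have rv : run (take j u) u = Some v by rewrite -{2}(cat_take_drop j u) run_self ev.
  have rs : run (drop l u) s = Some u by rewrite es /rot run_self cat_take_drop.
  have := rho' (take j u) (drop l u); rewrite !in_powP ?ctx0 // !run_cat rv /=.
  rewrite !run_cat e' /= rs => -[/(_ erefl) + _].
  by case e'': (run y' v) => [s'|] //= rs' ; rewrite (run_inj rs rs').
case ex: (run x v) => [s|]; first by rewrite (transfer x y s).
case ey: (run y v) => [s|] //; rewrite -ex; apply: (transfer y x) => //.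
by move=> p q; apply: iff_sym; exact: rxy.
Qed.

(** * Positions of a letter *)

(** Turns the [index] in [std_perm_map] into a count of earlier occurrences, which can be computed
    on the rows of the table. *)
Lemma positions_spec s a i : i < size s -> nth a s i = a ->
  i \in positions s a /\ index i (positions s a) = count_mem a (take i s).
Proof.
rewrite /positions => lti.
rewrite -{2 3}(add0n i); elim: s i 0 lti => // b s IHs [|i] m /=.
  by move=> _ ->; rewrite addn0 eqxx /= inE !eqxx.
rewrite ltnS => lti /(IHs _ m.+1 lti); rewrite addSnnS => -[mem idx].
case: eqP => [->|_] /=; last by rewrite mem idx add0n.
by rewrite inE mem orbT -[X in X == _]addn0 eqn_add2l /= idx add1n.
Qed.

Lemma positions_notin s a i : nth a s i != a -> i \notin positions s a.
Proof.
rewrite /positions -{2}(add0n i); elim: s i 0 => //= b s IHs i m nib.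
have tail : m + i \notin [seq p.1 | p <- zip (iota m.+1 (size s)) s & p.2 == a].
  case: i nib => [|i] /= nib; last by rewrite addnS -addSn IHs.
  apply/negP => /mapP[[k c]]; rewrite mem_filter => /andP[_ kc] /= ek.
  have : k \in iota m.+1 (size s).
    have := map_f fst kc; rewrite -/(unzip1 _) unzip1_zip ?size_iota //.
  by rewrite mem_iota -ek addn0 ltnn.
case: eqP => //= eb; rewrite inE negb_or tail andbT.
case: i nib {tail} => [|i] /=; first by rewrite eb eqxx.
by rewrite -{2}[m]addn0 eqn_add2l.
Qed.


(** * The Burrows-Wheeler table *)

Lemma bw_lcm_gt0 (us : seq (seq A)) : [::] \notin us -> 0 < bw_lcm us.
Proof.
rewrite /bw_lcm; elim: us => //= u us IHus; rewrite inE negb_or => /andP[u0 /IHus L0].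
by rewrite lcmn_gt0 L0 andbT lt0n size_eq0 eq_sym.
Qed.

Lemma dvdn_bw_lcm (us : seq (seq A)) u : u \in us -> size u %| bw_lcm us.
Proof.
rewrite /bw_lcm; elim: us => //= u' us IHus; rewrite inE => /predU1P[->|/IHus uus].
  exact: dvdn_lcml.
exact: dvdn_trans uus (dvdn_lcmr _ _).
Qed.

Lemma bw_rowsP (us : seq (seq A)) r :
  reflect (exists u v, [/\ u \in us, v \in necklace u & r = wpow v (bw_lcm us %/ size v)])
          (r \in bw_rows us).
Proof.
apply: (iffP flatten_mapP) => [[u uus /mapP[v vu ->]]|[u [v [uus vu ->]]]].
  by exists u, v.
by exists u => //; apply: map_f.
Qed.

Lemma size_bw_row (us : seq (seq A)) r : r \in bw_rows us -> size r = bw_lcm us.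
Proof.
case/bw_rowsP=> u [v [uus vu ->]].
by rewrite size_wpow divnK // (size_necklace vu) dvdn_bw_lcm.
Qed.

Lemma bw_row_nonnil (us : seq (seq A)) r : [::] \notin us -> r \in bw_rows us -> r != [::].
Proof. by move=> us0 /size_bw_row sr; rewrite -size_eq0 sr -lt0n bw_lcm_gt0. Qed.

Lemma perm_bw_rows_rot1 (us : seq (seq A)) :
  perm_eq (map (rot 1) (bw_rows us)) (bw_rows us).
Proof.
(* The common row length must stay fixed while the list shrinks, so it is generalised to an
   arbitrary [L]. *)
rewrite /bw_rows; elim: us (bw_lcm us) => //= u us IHus L.
rewrite map_cat; apply: perm_cat (IHus L).
have -> : map (rot 1) [seq wpow v (L %/ size v) | v <- necklace u] =
          [seq wpow v (L %/ size v) | v <- map (rot 1) (necklace u)].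
  by rewrite -!map_comp; apply: eq_map => v /=; rewrite wpow_rot1 size_rot.
exact/perm_map/perm_necklace_rot1.
Qed.

Lemma mem_bw_table (us : seq (seq A)) : bw_table us =i bw_rows us.
Proof. exact: mem_sort. Qed.

Lemma sorted_bw_table (us : seq (seq A)) : sorted (@lex_le d A) (bw_table us).
Proof. exact: sort_sorted lex_le_total _. Qed.

Lemma perm_bw_table_rot1 (us : seq (seq A)) :
  perm_eq (map (rot 1) (bw_table us)) (bw_table us).
Proof.
rewrite (perm_trans _ (_ : perm_eq (bw_rows us) _)) //; last by rewrite perm_sym perm_sort.
rewrite (perm_trans _ (perm_bw_rows_rot1 us)) // perm_map // perm_sort //.
Qed.

Lemma BW_last a (us : seq (seq A)) : [::] \notin us ->
  BW us = map (last a) (bw_table us).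
Proof.
move=> us0; rewrite /BW.
have : {in bw_table us, forall r, r != [::]}.
  by move=> r; rewrite mem_bw_table; exact: bw_row_nonnil.
elim: (bw_table us) => //= r t IHt nonnil.
rewrite IHt; last by move=> r' r't; apply: nonnil; rewrite inE r't orbT.
have := nonnil r; rewrite mem_head => /(_ isT).
by case/lastP: r {nonnil} => // r b _; rewrite rev_rcons last_rcons /= take0.
Qed.

(** The first column is nondecreasing because the rows are sorted. It has the letters of the last
    column, since the head of [r] is the last letter of [rot 1 r] and rotation permutes the rows. *)
Lemma sort_BW a (us : seq (seq A)) : [::] \notin us ->
  sort <=%O (BW us) = map (head a) (bw_table us).
Proof.
move=> us0; have nonnil : {in bw_table us, forall r, r != [::]}.
  by move=> r; rewrite mem_bw_table; exact: bw_row_nonnil.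
apply: (sorted_eq Order.POrderTheory.le_trans Order.POrderTheory.le_anti).
- exact: sort_sorted Order.TotalTheory.le_total _.
- rewrite sorted_map.
  apply: (sub_in_sorted (P := [pred r | r != [::]])) (sorted_bw_table us).
    move=> [|b r] [|c s] //= _ _.
    by case/orP => [/Order.POrderTheory.ltW|/andP[/eqP-> _]].
  by apply/allP.
rewrite perm_sort (BW_last a us0).
rewrite (_ : map (head a) _ = map (last a) (map (rot 1) (bw_table us))).
  by rewrite perm_map // perm_sym perm_bw_table_rot1.
rewrite -map_comp; apply/eq_in_map => r /nonnil.
by case: r => //= b r _; rewrite rot1_cons last_rcons.
Qed.

Lemma size_BW (us : seq (seq A)) : [::] \notin us -> size (BW us) = size (bw_table us).
Proof.
(* [BW_last] needs a default letter, taken here from the first word; with no word at all, both sizes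
   compute to 0. *)
case: us => // u us; rewrite inE negb_or => /andP[u0 us0].
case: u u0 => // a u _.
by rewrite (BW_last a) ?size_map // inE negb_or.
Qed.

(** * The standard permutation acting on the rows *)

Definition row_key (us : seq (seq A)) j :=
  (nth [::] (bw_table us) j, rank [::] (bw_table us) j).

Lemma row_key_inj (us : seq (seq A)) : [::] \notin us ->
  injective (fun j : 'I_(size (BW us)) => row_key us j).
Proof.
move=> us0 i j [eT er]; apply: val_inj; apply: rank_inj eT er.
  by rewrite -size_BW.
by rewrite -size_BW.
Qed.

(** A row and its rotation occur equally often in the table, so the copy of the rotation with the
    same rank exists. *)
Lemma exists_rot1_row (us : seq (seq A)) i : i < size (bw_table us) ->
  exists2 j, j < size (bw_table us) &
    row_key us j = (rot 1 (nth [::] (bw_table us) i), rank [::] (bw_table us) i).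
Proof.
set T := bw_table us => lti.
have : rank [::] T i < count_mem (rot 1 (nth [::] T i)) T.
  rewrite -(permP (perm_bw_table_rot1 us)) count_map.
  rewrite (eq_count (a2 := pred1 (nth [::] T i))) ?rank_lt_count // => r /=.
  by rewrite (inj_eq (@rot_inj _ _)).
case/(exists_count_take [::]) => j ltj [/eqP ej er].
by exists j; rewrite // /row_key -/T /rank ej er.
Qed.

(** The two columns describing [pi_a] are the first and the last of the table. Row [i] has the same
    place among the rows beginning with [a] as the equally ranked copy [j] of its rotation has among
    the rows ending with [a]. *)
Lemma row_key_std_perm (us : seq (seq A)) a (i : 'I_(size (BW us))) : [::] \notin us ->
  omap (fun j : 'I_ _ => row_key us j) (std_perm_map (BW us) a i) =
  omap (fun r => (r, rank [::] (bw_table us) i)) (step (nth [::] (bw_table us) i) a).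
Proof.
move=> us0; set T := bw_table us.
have lti : i < size T by rewrite -size_BW.
have rowT k : k < size T -> nth [::] T k \in bw_rows us.
  by move=> ltk; rewrite -mem_bw_table mem_nth.
have headT k : k < size T -> nth a (sort <=%O (BW us)) k = head a (nth [::] T k).
  by move=> ltk; rewrite (sort_BW a) // (nth_map [::]).
have lastT k : k < size T -> nth a (BW us) k = last a (nth [::] T k).
  by move=> ltk; rewrite (BW_last a) // (nth_map [::]).
rewrite ffunE /=.
case er: (nth [::] T i) (bw_row_nonnil us0 (rowT i lti)) => [//|b r'] _ /=.
(* If row [i] does not begin with [a], then [i] is no position of [a] in the first column and both
   sides are [None]. *)
have [eba|nba] := eqVneq b a; last first.
  by rewrite index_mem (negPf (positions_notin _)) // headT // er.
subst b; have [||ipos iidx] := @positions_spec (sort <=%O (BW us)) a i.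
- by rewrite size_sort.
- by rewrite headT // er.
rewrite index_mem ipos iidx.
have [j ltj] := exists_rot1_row lti; rewrite -/T er => ej.
have eTj : nth [::] T j = rcons r' a by case: ej => ->; rewrite rot1_cons.
have [||jpos jidx] := @positions_spec (BW us) a j.
- by rewrite size_BW.
- by rewrite lastT // eTj last_rcons.
suff -> : count_mem a (take i (sort <=%O (BW us))) = count_mem a (take j (BW us)).
  rewrite -jidx nth_index // insubT ?size_BW //= => ltj'.
  by congr Some; rewrite ej rot1_cons.
have cnt (P : pred (seq A)) k : k < size T -> P (nth [::] T k) -> count P (take k T) =
    count (fun s => P s && ~~ lex_le (nth [::] T k) s) T + rank [::] T k.
  exact: count_take_sorted lex_le_trans lex_le_refl lex_le_anti (sorted_bw_table us).
have -> : take j (BW us) = take j (map (last a) T) by rewrite (BW_last a).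
rewrite (sort_BW a) // -!map_take !count_map.
rewrite (cnt (preim (head a) (pred1 a))) //=; last by rewrite er eqxx.
rewrite (cnt (preim (last a) (pred1 a))) //=; last by rewrite eTj last_rcons eqxx.
rewrite er eTj.
have -> : rank [::] T j = rank [::] T i by case: ej.
(* The ranks agree; rotation matches the smaller rows beginning with [a] with the smaller rows
   ending with [a], by [lex_le_rcons]. *)
congr (_ + _); rewrite -[RHS](permP (perm_bw_table_rot1 us)) count_map.
apply: eq_in_count => s; rewrite mem_bw_table => sT /=.
have ssz : size s = (size r').+1.
  by rewrite (size_bw_row sT) -(size_bw_row (rowT i lti)) er.
case: s {sT} ssz => //= c s [ssz]; rewrite rot1_cons last_rcons.
case: eqP => [->|] //=.
by rewrite eqxx Order.POrderTheory.ltxx lex_le_rcons.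
Qed.


(** * Partial maps induced by words *)

Lemma pcompA n (f g h : pmap n) : pcomp f (pcomp g h) = pcomp (pcomp f g) h.
Proof. by apply/ffunP => i; rewrite !ffunE; case: (f i) => //= j; rewrite ffunE. Qed.

Definition idpmap n : pmap n := [ffun i => Some i].

Lemma idpmap_comp n (f : pmap n) : pcomp (idpmap n) f = f.
Proof. by apply/ffunP => i; rewrite !ffunE. Qed.

Lemma comp_idpmap n (f : pmap n) : pcomp f (idpmap n) = f.
Proof. by apply/ffunP => i; rewrite !ffunE; case: (f i) => //= j; rewrite ffunE. Qed.

(** The empty word gives the identity, which may lie outside the generated semigroup; [generatedP]
    therefore speaks of nonempty words. *)
Definition word_map (us : seq (seq A)) x : pmap (size (BW us)) :=
  foldr (fun a f => pcomp (std_perm_map (BW us) a) f) (idpmap _) x.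

Lemma word_map_cat (us : seq (seq A)) x y :
  word_map us (x ++ y) = pcomp (word_map us x) (word_map us y).
Proof. by elim: x => [|a x IHx] /=; rewrite ?idpmap_comp // IHx pcompA. Qed.

Lemma generatedP (us : seq (seq A)) (f : pmap (size (BW us))) :
  generated (fun g => exists a : A, g = std_perm_map (BW us) a) f <->
  exists2 x, x != [::] & f = word_map us x.
Proof.
split=> [|[x x0 ->]].
  elim=> [_ [a ->]|g h _ [x x0 ->] _ [y y0 ->]].
    by exists [:: a]; rewrite //= comp_idpmap.
  by exists (x ++ y); rewrite ?word_map_cat ?cat_nonnil.
elim: x x0 => // a [|b x] IHx _.
  by rewrite /= comp_idpmap; apply: gen_base; exists a.
by apply: gen_comp; [apply: gen_base; exists a | exact: IHx].
Qed.

Lemma row_key_word_map (us : seq (seq A)) x (i : 'I_(size (BW us))) : [::] \notin us ->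
  omap (fun j : 'I_ _ => row_key us j) (word_map us x i) =
  omap (fun r => (r, rank [::] (bw_table us) i)) (run x (nth [::] (bw_table us) i)).
Proof.
move=> us0; elim: x i => [|a x IHx] i /=; first by rewrite ffunE.
rewrite ffunE; have := row_key_std_perm a i us0.
case: (std_perm_map _ a i) => [j|]; case: (step _ a) => [r|] //= [eT er].
by rewrite IHx er eT.
Qed.

Lemma omap_injective (S U : Type) (f : S -> U) : injective f -> injective (omap f).
Proof. by move=> injf [x|] [y|] //= [/injf ->]. Qed.

(** By [row_key_inj] a partial map is determined by the keys of its values, and [x] enters these
    keys only through [run x]. *)
Lemma word_map_eq_rows (us : seq (seq A)) x y : [::] \notin us ->
  word_map us x = word_map us y <-> {in bw_rows us, run x =1 run y}.
Proof.
move=> us0; split=> [exy r|exy].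
  rewrite -mem_bw_table => /(nthP [::]) [i]; rewrite -size_BW // => lti <-.
  have := row_key_word_map x (Ordinal lti) us0.
  rewrite exy row_key_word_map //= => /omap_injective -> // r1 r2 [] //.
apply/ffunP => i; apply: (omap_injective (row_key_inj us0)).
by rewrite !row_key_word_map // exy // -mem_bw_table mem_nth // -size_BW.
Qed.

(** Rows are positive powers of conjugates: [run_wpow] passes to the rows, and [wpow_inj] comes
    back. *)
Lemma word_map_eq (us : seq (seq A)) x y : [::] \notin us ->
  word_map us x = word_map us y <->
  {in us, forall u, {in necklace u, run x =1 run y}}.
Proof.
move=> us0; rewrite word_map_eq_rows //.
have k0 u v : u \in us -> v \in necklace u -> 0 < bw_lcm us %/ size v.
  move=> uus vu; rewrite (size_necklace vu) divn_gt0.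
    exact: dvdn_leq (bw_lcm_gt0 us0) (dvdn_bw_lcm uus).
  by rewrite lt0n size_eq0; apply: contraNneq us0 => <-.
split=> [exy u uus v vu|exy r /bw_rowsP[u [v [uus vu ->]]]]; last first.
  by rewrite !run_wpow ?(k0 u) // (exy u).
set k := bw_lcm us %/ size v.
have : run x (wpow v k) = run y (wpow v k).
  by apply: exy; apply/bw_rowsP; exists u, v.
rewrite !run_wpow ?(k0 u) //.
case ex: (run x v) => [s|]; case ey: (run y v) => [s'|] //= [e].
by rewrite (wpow_inj (k0 u v uus vu) _ e) // (size_run ex) (size_run ey).
Qed.

Lemma word_map_eq_rho (us : seq (seq A)) x y :
    (forall u, u \in us -> primitive u) -> x != [::] -> y != [::] ->
  word_map us x = word_map us y <-> forall u, u \in us -> rho u x y.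
Proof.
move=> prim x0 y0.
have us0 : [::] \notin us by apply/negP => /prim[].
rewrite word_map_eq //; split=> exy u uus.
  by apply/(rho_run (prim u uus) x0 y0)/exy.
by apply/(rho_run (prim u uus) x0 y0)/exy.
Qed.

(** * The syntactic semigroup as a quotient *)

Lemma rho_sym u x y : rho u x y -> rho u y x.
Proof. by move=> h p q; apply: iff_sym; exact: h. Qed.

Lemma rho_trans u x y z : rho u x y -> rho u y z -> rho u x z.
Proof. by move=> h k p q; apply: iff_trans (h p q) (k p q). Qed.

Lemma rho_cat u x y x' y' : rho u x x' -> rho u y y' -> rho u (x ++ y) (x' ++ y').
Proof.
move=> hx hy p q; apply: iff_trans (_ : in_pow u (p ++ (x' ++ y) ++ q) <-> _).
  by rewrite -!(catA _ y); exact: hx.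
by have := hy (p ++ x') q; rewrite -!catA.
Qed.

Lemma rho_class_eq u x y : y != [::] -> rho_class u x = rho_class u y <-> rho u x y.
Proof.
move=> y0; split=> [e|h].
  by have [_ //] : rho_class u x y by rewrite e; split.
apply: functional_extensionality => z; apply: propositional_extensionality.
rewrite /rho_class; split=> -[z0 hz]; split=> //; [exact: rho_trans (rho_sym h) hz | exact: (rho_trans h hz)].
Qed.

Definition Su_class u x (x0 : x != [::]) : Su_carrier u :=
  exist _ (rho_class u x) (ex_intro _ x (conj x0 erefl)).

Lemma Su_carrier_eq u (C D : Su_carrier u) : proj1_sig C = proj1_sig D -> C = D.
Proof.
case: C D => [C pC] [D pD] /= e; subst D; congr exist; exact: proof_irrelevance.
Qed.

Lemma Su_class_eq u x y (x0 : x != [::]) (y0 : y != [::]) :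
  Su_class u x0 = Su_class u y0 <-> rho u x y.
Proof.
split=> [[e]|h]; first exact/(rho_class_eq u x y0).
by apply: Su_carrier_eq; apply/rho_class_eq.
Qed.

(** [Su_op] multiplies chosen representatives; the choice is harmless because [rho] is a
    congruence. *)
Lemma Su_class_op u x y (x0 : x != [::]) (y0 : y != [::]) :
  Su_op (Su_class u x0) (Su_class u y0) = Su_class u (cat_nonnil y x0).
Proof.
have rep t (t0 : t != [::]) : rho u (Su_rep (Su_class u t0)) t.
  have [r0 /= e] := Su_rep_spec (Su_class u t0).
  by apply/rho_class_eq.
by apply: Su_carrier_eq; apply/rho_class_eq; [exact: cat_nonnil|exact: rho_cat].
Qed.

Lemma SM_word (us : seq (seq A)) (f : SM us) :
  exists x, x != [::] /\ proj1_sig f = word_map us x.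
Proof. by case: f => f /= /generatedP [x]; exists x. Qed.

End Words.

(** * The embedding into the product of syntactic semigroups *)

Theorem theorem2p6 (d : Order.disp_t) (A : finOrderType d) (us : seq (seq A)) :
  (forall u, u \in us -> primitive u) ->
  iso_to_subdirect (SM us) (fun i : 'I_(size us) => Su (nth [::] us i)).
Proof.
move=> prim.
(* Many words may induce the same element; one is chosen, and by [word_map_eq_rho] its classes do
   not depend on the choice. *)
pose word (f : SM us) := proj1_sig (constructive_indefinite_description _ (SM_word f)).
have word_spec f : word f != [::] /\ proj1_sig f = word_map us (word f).
  exact: (proj2_sig (constructive_indefinite_description _ (SM_word f))).
pose F (f : SM us) (i : 'I_(size us)) : Su (nth [::] us i) :=
  Su_class (nth [::] us i) (proj1 (word_spec f)).
have FM f g : F (mop f g) = prod_op (F f) (F g).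
  apply: functional_extensionality_dep => i.
  (* The word chosen for a product may differ from the concatenation of the chosen words, but both
     induce the same map. *)
  rewrite /prod_op /= Su_class_op; apply/Su_class_eq.
  apply: (proj1 (word_map_eq_rho prim _ _)); rewrite ?mem_nth //.
  - by have [] := word_spec (mop f g).
  - by apply: cat_nonnil; have [] := word_spec f.
  rewrite word_map_cat; have [_ <-] := word_spec (mop f g).
  by have [_ <-] := word_spec f; have [_ <-] := word_spec g.
(* The subsemigroup is the image of [F], closed under products by [FM]. *)
exists (fun p => exists f, F f = p); split; [split|exists F; split=> //; split=> //].
- by move=> _ _ [f <-] [g <-]; exists (mop f g).
- move=> i [C [x [x0 eC]]].
  (* Surjectivity on a factor: the map induced by [x] is an element whose chosen word is
     [rho]-equivalent to [x]. *)
  pose f : SM us := exist _ (word_map us x) (proj2 (generatedP _) (ex_intro2 _ _ x x0 erefl)).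
  exists (F f); split; first by exists f.
  apply: Su_carrier_eq; rewrite /= eC; apply/rho_class_eq => //.
  have [w0 /= ew] := word_spec f.
  by apply: (proj1 (word_map_eq_rho prim w0 x0)); rewrite ?mem_nth.
move=> f g efg; have [f0 ef] := word_spec f; have [g0 eg] := word_spec g.
(* Equal components make the chosen words equivalent for every word of [us], hence they induce the
   same map. *)
have efg' : proj1_sig f = proj1_sig g.
  rewrite ef eg; apply/(word_map_eq_rho prim f0 g0) => _ /(nthP [::]) [i lti <-].
  apply/(@Su_class_eq _ _ (nth [::] us i) _ _ (proj1 (word_spec f)) (proj1 (word_spec g))).
  exact: (congr1 (fun p => p (Ordinal lti)) efg).
case: f g efg' {efg f0 ef g0 eg} => [f pf] [g pg] /= e.
by subst g; congr exist; exact: proof_irrelevance.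
Qed.
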